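(* Let $D$ be a distribution on $X\times Y$, let $S=\{(x_i,y_i)\}_{i=1}^n\sim D^n$, let $\mathcal H=\{h_w:w\in\mathbb R^m\}$ be a hypothesis class, let $L$ be a real-valued loss function, and let $P$ be a prior distribution on $\mathbb R^m$. Fix $\delta\in(0,1]$ and $\lambda>0$. For any distribution $Q$ on $\mathbb R^m$ (for which the expectations below are defined) and any sample $S$, put $\overline w:=\mathbb E_{w\sim Q}[w]$ and $$\Omega_{L,Q,D,S}(n):=\Big(L_D(h_{\overline w})-\mathbb E_{w\sim Q}L_D(h_w)\Big)-\Big(L_S(h_{\overline w})-\mathbb E_{w\sim Q}L_S(h_w)\Big).$$ Then, with probability at least $1-\delta$ over the draw of $S$, simultaneously for all distributions $Q$ on $\mathbb R^m$, $$L_D(h_{\overline w})\le L_S(h_{\overline w})+\Omega_{L,Q,D,S}(n)+\frac1\lambda\Big[D_{\mathrm{KL}}(Q\|P)+\ln\tfrac1\delta+\Psi_{L,P,D}(\lambda,n)\Big],$$ where $$\Psi_{L,P,D}(\lambda,n):=\ln\mathbb E_{w\sim P}\,\mathbb E_{S\sim D^n}\exp\big[\lambda\,(L_D(h_w)-L_S(h_w))\big].$$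
   Context: For a hypothesis $h$, $L_D(h):=\mathbb E_{(x,y)\sim D}[L(h(x),y)]$ and $L_S(h):=\frac1n\sum_{i=1}^n L(h(x_i),y_i)$. $D_{\mathrm{KL}}(Q\|P)$ is the Kullback–Leibler divergence. *)

(* Defs.v *)
From HB Require Import structures.
From mathcomp Require Import all_boot all_order all_algebra.
From mathcomp Require Import all_classical all_reals all_analysis.
From mathcomp Require Import measurable_realfun.

Set Implicit Arguments.
Unset Strict Implicit.
Unset Printing Implicit Defensive.

Import Order.TTheory GRing.Theory Num.Theory.
Import numFieldNormedType.Exports.

Local Open Scope classical_set_scope.
Local Open Scope ring_scope.

Section power_probability.
Context d (T : measurableType d) (R : realType).

Definition cons_pair n (xt : T * n.-tuple T) : n.+1.-tuple T :=
  [the n.+1.-tuple T of xt.1 :: xt.2].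

Let measurable_cons_pair n : measurable_fun [set: T * n.-tuple T] (@cons_pair n).
Proof. exact: measurable_cons. Qed.

HB.instance Definition _ n :=
  isMeasurableFun.Build _ _ (T * n.-tuple T)%type (n.+1.-tuple T)
    (@cons_pair n) (@measurable_cons_pair n).

(* The [n]-fold product measure, on the product sigma-algebra of
   [n.-tuple T]; see [power_probability_box]. *)
Fixpoint power_probability (D : probability T R) (n : nat) :
    probability (n.-tuple T) R :=
  match n with
  | 0 => \d_([tuple] : 0.-tuple T)
  | k.+1 => distribution (D \x power_probability D k)%E (@cons_pair k)
  end.

Lemma power_probability_box (D : probability T R) n (A : 'I_n -> set T) :
  (forall i, measurable (A i)) ->
  power_probability D n [set t | forall i, A i (tnth t i)] =
  (\prod_(i < n) D (A i))%E.
Proof.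
elim: n A => [|n IHn] A mA.
  rewrite big_ord0 /= diracE mem_set //.
  by case.
rewrite big_ord_recl -IHn; last by move=> i; exact: mA.
rewrite /= /distribution /pushforward.
rewrite -product_measure1E //; last first.
  rewrite (_ : [set t | _] = \bigcap_(i in [set: 'I_n])
    ((@tnth n T ^~ i) @^-1` A (lift ord0 i))); last first.
    by apply/seteqP; split => [t /= H i _|t /= H i]; exact: H.
  apply: fin_bigcap_measurable => // i _.
  by rewrite -[X in measurable X]setTI; apply: measurable_tnth.
congr (_ _); apply/seteqP; split => -[x t] /= H.
  split; first by have := H ord0.
  by move=> i; have := H (lift ord0 i); rewrite tnthS.
move=> i; case: H => H0 H1.
have [->|i0] := eqVneq i ord0; first exact: H0.
case: (unliftP ord0 i) i0 => [j ->|->]; last by rewrite eqxx.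
by rewrite tnthS => _; exact: H1.
Qed.

End power_probability.

Section kullback_leibler.
Context d (T : measurableType d) (R : realType).
Local Open Scope ereal_scope.
Local Open Scope charge_scope.

(* [ln] is only evaluated at the values of a Radon-Nikodym derivative, which
   are finite, and [Q]-almost everywhere positive. The negative part of the
   integrand is always [Q]-integrable, so that the expectation is well-defined
   in [0, +oo]. *)
Definition KL_divergence (Q P : probability T R) : \bar R :=
  if `[< Q `<< P >]
  then 'E_Q[fun w => ln (fine (('d (charge_of_finite_measure Q) '/d P) w))]
  else +oo.

End kullback_leibler.

Section pac_bayes.
Context dX dY (X : measurableType dX) (Y : measurableType dY) (R : realType).
Context (Z : Type) (L : Z -> Y -> R).

Definition risk (D : probability (X * Y)%type R) (h : X -> Z) : R :=
  fine 'E_D[fun xy => L (h xy.1) xy.2]%E.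

Definition finite_risk (D : probability (X * Y)%type R) (h : X -> Z) : Prop :=
  D.-integrable [set: X * Y] (EFin \o (fun xy => L (h xy.1) xy.2)).

Definition empirical_risk n (S : n.-tuple (X * Y)) (h : X -> Z) : R :=
  n%:R^-1 * \sum_(i < n) L (h (tnth S i).1) (tnth S i).2.

Context (m : nat) (h : m.-tuple R -> X -> Z).

Definition mean_weight (Q : probability (m.-tuple R) R) : m.-tuple R :=
  [tuple fine 'E_Q[fun w => tnth w i]%E | i < m].

(* All the expectations entering the bound for [Q] and [S] (other than the
   divergence, which may be infinite) exist and are finite. *)
Record admissible (D : probability (X * Y)%type R) n (S : n.-tuple (X * Y))
    (Q : probability (m.-tuple R) R) : Prop := Admissible {
  admissible_mean : forall i : 'I_m,
    Q.-integrable [set: m.-tuple R] (EFin \o (fun w => tnth w i));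
  admissible_risk_mean : finite_risk D (h (mean_weight Q));
  admissible_risk : {ae Q, forall w, finite_risk D (h w)};
  admissible_mean_risk :
    Q.-integrable [set: m.-tuple R] (EFin \o (fun w => risk D (h w)));
  admissible_mean_empirical_risk :
    Q.-integrable [set: m.-tuple R] (EFin \o (fun w => empirical_risk S (h w)))
}.

Definition Omega (D : probability (X * Y)%type R) n (S : n.-tuple (X * Y))
    (Q : probability (m.-tuple R) R) : R :=
  (risk D (h (mean_weight Q)) - fine 'E_Q[fun w => risk D (h w)]%E)
  - (empirical_risk S (h (mean_weight Q))
     - fine 'E_Q[fun w => empirical_risk S (h w)]%E).

(* Extended-real valued: the exponential moment may be infinite. *)
Definition Psi (P : probability (m.-tuple R) R)
    (D : probability (X * Y)%type R) (lambda : R) (n : nat) : \bar R :=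
  lne (\int[P]_w
    'E_(power_probability D n)[fun S : n.-tuple (X * Y) =>
       expR (lambda * (risk D (h w) - empirical_risk S (h w)))])%E.

End pac_bayes.

(* Main.v *)
(* By the definition of Omega the claim is
   [E_Q (L_D - L_S) <= (KL + ln (1/delta) + Psi) / lambda].  The exponential
   moment [G S] of [lambda (L_D - L_S)] under the prior has expectation
   [exp Psi] over the sample (Tonelli), so by Markov's inequality
   [G S < exp Psi / delta] with probability at least [1 - delta]; this event
   does not depend on Q, and on it the Donsker-Varadhan inequality
   [E_Q phi <= KL (Q | P) + ln E_P (exp phi)] gives the bound for all Q at once. *)

Require Import Defs.
From mathcomp Require Import all_boot all_order all_algebra.
From mathcomp Require Import all_classical all_reals all_analysis.
From mathcomp Require Import measurable_realfun.
From mathcomp Require Import lra.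

Import Order.TTheory GRing.Theory Num.Theory.
Import numFieldNormedType.Exports.

Local Open Scope classical_set_scope.
Local Open Scope ring_scope.

(** Positive and negative parts are compared separately, so the integrals may be infinite, as that
    of the log-density may be in [KL_change_of_measure]. *)
Lemma le_integral_measurable d (T : measurableType d) (R : realType)
    (mu : {measure set T -> \bar R}) (f g : T -> \bar R) :
  measurable_fun [set: T] f -> measurable_fun [set: T] g ->
  (forall x, f x <= g x)%E -> (\int[mu]_x f x <= \int[mu]_x g x)%E.
Proof.
move=> mf mg fg; rewrite [leLHS]integralE [leRHS]integralE.
apply: leeB; apply: ge0_le_integral => //; try exact: measurable_funepos;
  try exact: measurable_funeneg.
- by move=> x _; apply: (@funepos_le _ _ setT) => //; rewrite inE.
- by move=> x _; apply: (@funeneg_le _ _ setT) => //; rewrite inE.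
Qed.

(** A zero integral would make [f] vanish almost everywhere, so the whole space would be null. This
    puts the exponential moments in the domain of the logarithm. *)
Lemma probability_integral_gt0 d (T : measurableType d) (R : realType)
    (mu : probability T R) (f : T -> \bar R) :
  measurable_fun [set: T] f -> (forall x, 0 < f x)%E ->
  (0 < \int[mu]_x f x)%E.
Proof.
move=> mf f0; rewrite lt0e integral_ge0 ?andbT; last by move=> x _; exact: ltW.
apply/eqP => If0; have : (\int[mu]_x `|f x| = 0)%E.
  by rewrite -[RHS]If0; apply: eq_integral => x _; rewrite gee0_abs ?ltW.
move/(ae_eq_integral_abs _ measurableT mf) => [N [mN N0 NT]].
have NE : N = setT.
  apply/seteqP; split=> // x _; apply: NT => /= /(_ I) fx0.
  by have := f0 x; rewrite fx0 ltxx.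
by have := probability_setT mu; rewrite -NE N0 => /eqP; rewrite eqe eq_sym oner_eq0.
Qed.

Lemma probability_markov d (T : measurableType d) (R : realType)
    (mu : probability T R) (f : T -> \bar R) (M delta : R) :
  measurable_fun [set: T] f -> (forall x, 0 <= f x)%E ->
  0 < M -> 0 < delta -> (\int[mu]_x f x <= M%:E)%E ->
  ((1 - delta)%:E <= mu [set x | f x < (M / delta)%:E])%E.
Proof.
move=> mf f0 M0 d0 fM; have Md0 : 0 < M / delta by rewrite divr_gt0.
have mA : measurable [set x | f x < (M / delta)%:E]%E.
  by rewrite -[X in measurable X]setTI; exact: emeasurable_fun_infty_o.
(* Markov's inequality at level [M / delta]; the good event is the complement of the set it
   bounds. *)
have := @le_integral_comp_abse _ _ _ mu _ measurableT f (M / delta) id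
  (@measurable_id _ _ _) (fun _ => id) (fun _ _ _ _ => id) mf Md0.
rewrite setTI.
have -> : [set x | ((M / delta)%:E <= `|f x|)%E] =
    ~` [set x | (f x < (M / delta)%:E)%E].
  by apply/seteqP; split=> x /=; rewrite gee0_abs // leNgt => /negP.
under eq_integral do rewrite gee0_abs//.
move=> /le_trans /(_ fM) /=; rewrite (probability_setC mu mA).
set p := mu _; have : p \is a fin_num by rewrite fin_num_measure.
case: p => // p _; rewrite /= -EFinB -EFinM !lee_fin => H.
suff : 1 - p <= delta by lra.
by rewrite -(ler_pM2l Md0) divfK ?gt_eqF.
Qed.

Section change_of_measure.
Context d (T : measurableType d) (R : realType) (Q P : probability T R).
Local Open Scope ereal_scope.
Local Open Scope charge_scope.
Local Notation density := (Radon_Nikodym_SigmaFinite.f Q P).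

(* [KL_divergence] is defined with the derivative of [Q] seen as a charge, which
   is only almost everywhere nonnegative; [density] is so everywhere. *)
Lemma KL_divergence_density : Q `<< P ->
  KL_divergence Q P = \int[Q]_w (ln (fine (density w)))%:E.
Proof.
move=> QP; rewrite /KL_divergence asboolT// unlock.
have mf := measurable_int _ (Radon_Nikodym_SigmaFinite.f_integrable QP).
apply: ae_eq_integral => //.
- apply/measurable_EFinP; apply: measurableT_comp => //.
  exact: measurableT_comp.
- apply/measurable_EFinP; apply: measurableT_comp => //.
  exact: measurableT_comp.
- apply: (null_dominates_ae_eq measurableT QP).
  have := ae_eq_Radon_Nikodym_SigmaFinite QP measurableT.
  by apply: filterS => w /(_ I) -> _.
Qed.

(* Donsker-Varadhan: integrate [1 + t <= expR t] at [t = phi - c - ln (dQ/dP)] against [Q]. *)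
Lemma KL_change_of_measure (phi : T -> R) (c : R) :
  Q.-integrable [set: T] (EFin \o phi) ->
  \int[P]_w (expR (phi w))%:E <= (expR c)%:E ->
  'E_Q[phi] <= KL_divergence Q P + c%:E.
Proof.
move=> iphi phic.
have [QP|nQP] := pselect (Q `<< P); last first.
  by rewrite /KL_divergence asboolF// addye// leey.
rewrite KL_divergence_density//.
have mf := measurable_int _ (Radon_Nikodym_SigmaFinite.f_integrable QP).
have mphi : measurable_fun setT phi by apply/measurable_EFinP; exact: measurable_int iphi.
pose r w := fine (density w); have mr : measurable_fun setT r by exact: measurableT_comp.
have rE w : density w = (r w)%:E.
  by rewrite fineK// Radon_Nikodym_SigmaFinite.f_fin_num.
have r0 w : (0 <= r w)%R by rewrite fine_ge0// Radon_Nikodym_SigmaFinite.f_ge0.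
pose k w := expR (phi w - c - ln (r w)).
have k0 w : (0 <= k w)%R by exact: expR_ge0.
have mlnr : measurable_fun setT (fun w => ln (r w)) by exact: measurableT_comp.
have mk : measurable_fun setT k.
  by apply: measurableT_comp => //; apply: measurable_funB => //;
  exact: measurable_funB.
(* Writing [Q] as [r] times [P] turns the integrand into at most [expR (phi - c)], whose
   [P]-integral is at most 1 by the choice of [c]. *)
have Ik : \int[Q]_w (k w)%:E <= 1.
  rewrite -(Radon_Nikodym_SigmaFinite.change_of_variables QP)//; last exact/measurable_EFinP.
  apply: (@le_trans _ _ (\int[P]_w ((expR (- c))%:E * (expR (phi w))%:E))).
    apply: ge0_le_integral => //.
    - by move=> w _; rewrite rE -EFinM lee_fin mulr_ge0.
    - by apply: emeasurable_funM => //; exact/measurable_EFinP.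
    - apply: measurable_funeM; apply/measurable_EFinP; exact: measurableT_comp.
    - move=> w _; rewrite rE -!EFinM lee_fin -expRD [(- c + _)%R]addrC /k.
      (* Where the density vanishes, [ln] has only a default value, but the factor [r w] kills the
         product; elsewhere equality holds. *)
      have [->|rw0] := eqVneq (r w) 0%R; first by rewrite mulr0 expR_ge0.
      by rewrite expRB lnK ?divfK// posrE lt0r rw0 r0.
  rewrite ge0_integralZl ?lee_fin ?expR_ge0//; last first.
    by apply/measurable_EFinP; exact: measurableT_comp.
  apply: (@le_trans _ _ ((expR (- c))%:E * (expR c)%:E)).
    by apply: lee_wpmul2l => //; rewrite lee_fin expR_ge0.
  by rewrite -EFinM expRN mulVf// gt_eqF// expR_gt0.
have ik : Q.-integrable [set: T] (EFin \o k).
  apply/integrableP; split; first exact/measurable_EFinP.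
  under eq_integral do rewrite /= ger0_norm//.
  by rewrite (le_lt_trans Ik)// ltry.
have icst : Q.-integrable [set: T] (EFin \o cst (1 - c)%R).
  exact: finite_measure_integrable_cst.
(* The inequality [1 + t <= expR t] solved for [ln r]: the left side is integrable, while the
   integral of the right side may be infinite. *)
have ile : \int[Q]_w ((phi w)%:E + (1 - c)%:E - (k w)%:E) <=
    \int[Q]_w (ln (fine (density w)))%:E.
  apply: le_integral_measurable.
  - apply: emeasurable_funB; last exact/measurable_EFinP.
    by apply: emeasurable_funD => //; exact/measurable_EFinP.
  - exact/measurable_EFinP.
  - move=> w; rewrite lee_fin.
    have := expR_ge1Dx (phi w - c - ln (r w)); rewrite -/(k w) /r; lra.
rewrite unlock -leeBlDr// (le_trans _ ile)//.
rewrite integralB//; last exact: integrableD.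
have IcstE : \int[Q]_w (1 - c)%:E = (1 - c)%:E.
  by have := expectation_cst Q (1 - c)%R; rewrite unlock.
rewrite integralD// IcstE.
have : \int[Q]_w (phi w)%:E \is a fin_num by rewrite integrable_fin_num.
have : \int[Q]_w (k w)%:E \is a fin_num by rewrite integrable_fin_num.
move: Ik; case: (\int[Q]_w (k w)%:E) => // kk; case: (\int[Q]_w (phi w)%:E) => // p.
rewrite !lee_fin; lra.
Qed.

(** Change of measure with [phi = 0] and [c = 0]. It excludes the value [-oo] when the divergence is
    added to an infinite [Psi]. *)
Lemma KL_divergence_ge0 : 0 <= KL_divergence Q P.
Proof.
have := @KL_change_of_measure (cst 0%R) 0%R.
rewrite expectation_cst adde0; apply.
- exact: finite_measure_integrable_cst.
- by have := expectation_cst P (expR 0%R); rewrite unlock => ->.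
Qed.

End change_of_measure.

Section measurability.
Context (dW dX dY : measure_display) (W : measurableType dW) (X : measurableType dX).
Context (Y : measurableType dY) (R : realType) (Z : Type) (L : Z -> Y -> R).
Context (h : W -> X -> Z).
Hypothesis measurable_loss : measurable_fun [set: W * (X * Y)]
  (fun wxy => L (h wxy.1 wxy.2.1) wxy.2.2).

(** The loss is signed, so Tonelli is applied to its positive and negative parts; [fine] then gives
    a measurable function even at weights of infinite risk. *)
Lemma measurable_risk (D : probability (X * Y)%type R) :
  measurable_fun [set: W] (fun w => risk L D (h w)).
Proof.
rewrite /risk unlock; apply: measurableT_comp => //.
pose l wxy := (L (h wxy.1 wxy.2.1) wxy.2.2)%:E : \bar R.
have ml : measurable_fun [set: W * (X * Y)] l by exact/measurable_EFinP.
rewrite (_ : (fun w => _) = (fun w => fubini_F D l^\+ w - fubini_F D l^\- w)%E).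
  by apply: emeasurable_funB; apply: measurable_fun_fubini_tonelli_F => //;
    [exact: measurable_funepos|exact: measurable_funeneg].
apply/funext => w; rewrite integralE /fubini_F.
by congr (_ - _)%E; apply: eq_integral => xy _;
  rewrite ?funeposE ?funenegE.
Qed.

Lemma measurable_empirical_risk n :
  measurable_fun [set: W * n.-tuple (X * Y)]
    (fun wS => empirical_risk L wS.2 (h wS.1)).
Proof.
apply: measurable_funM => //; apply: measurable_sum => i.
apply: (measurableT_comp measurable_loss
  (g := fun wS : W * n.-tuple (X * Y) => (wS.1, tnth wS.2 i))).
apply: measurable_fun_pair => //.
apply: (measurableT_comp (measurable_tnth i)); exact: measurable_snd.
Qed.

Lemma measurable_generalization_gap (D : probability (X * Y)%type R) n :
  measurable_fun [set: W * n.-tuple (X * Y)]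
    (fun wS => risk L D (h wS.1) - empirical_risk L wS.2 (h wS.1)).
Proof.
apply: measurable_funB; last exact: measurable_empirical_risk.
by apply: (measurableT_comp (measurable_risk D)); exact: measurable_fst.
Qed.

End measurability.

Theorem theorem3p3 (R : realType)
  (dX dY : measure_display) (X : measurableType dX) (Y : measurableType dY)
  (D : probability (X * Y)%type R)
  (n : nat) (n_gt0 : (0 < n)%N)
  (m : nat) (Z : Type) (h : m.-tuple R -> X -> Z) (L : Z -> Y -> R)
  (measurable_loss : measurable_fun [set: m.-tuple R * (X * Y)]
     (fun wxy => L (h wxy.1 wxy.2.1) wxy.2.2))
  (P : probability (m.-tuple R) R)
  (finite_risk_prior : {ae P, forall w, finite_risk L D (h w)})
  (delta : R) (delta_gt0 : 0 < delta) (delta_le1 : delta <= 1)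
  (lambda : R) (lambda_gt0 : 0 < lambda) :
  exists2 A : set (n.-tuple (X * Y)),
    measurable A /\ ((1 - delta)%:E <= power_probability D n A)%E &
    forall S : n.-tuple (X * Y), A S ->
    forall Q : probability (m.-tuple R) R, admissible L h D S Q ->
    ((risk L D (h (mean_weight Q)))%:E <=
     (empirical_risk L S (h (mean_weight Q)))%:E
     + (Omega L h D S Q)%:E
     + (lambda^-1)%:E * (KL_divergence Q P + (ln (1 / delta))%:E
                         + Psi L h P D lambda n))%E.
Proof.
pose gap w (S : n.-tuple (X * Y)) := risk L D (h w) - empirical_risk L S (h w).
pose F wS := (expR (lambda * gap wS.1 wS.2))%:E.
have mF : measurable_fun [set: m.-tuple R * n.-tuple (X * Y)] F.
  apply/measurable_EFinP; apply: measurableT_comp => //; apply: measurable_funM => //.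
  exact: measurable_generalization_gap.
have F_gt0 wS : (0 < F wS)%E by rewrite lte_fin expR_gt0.
have F_ge0 wS : (0 <= F wS)%E by exact: ltW.
pose G S := (\int[P]_w F (w, S))%E.
have mG : measurable_fun setT G by exact: measurable_fun_fubini_tonelli_G.
have G_gt0 S : (0 < G S)%E.
  apply: probability_integral_gt0 => //; exact: measurable_fun_pair1.
pose M := (\int[power_probability D n]_S G S)%E.
have M_gt0 : (0 < M)%E by exact: probability_integral_gt0.
(* [M] integrates over the prior inside and the sample outside, [Psi] the other way round; they
   agree by Tonelli as [F] is nonnegative. *)
have PsiE : Psi L h P D lambda n = lne M.
  by rewrite /Psi /M -fubini_tonelli// unlock.
rewrite PsiE {PsiE}.
(* Unfolding [Omega] cancels the terms at the mean weight and leaves the mean gap under [Q]. The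
   constant [c] is extended-real to serve both finite and infinite [M]. *)
have bound (S : n.-tuple (X * Y)) (Q : probability (m.-tuple R) R) (c : \bar R) :
    admissible L h D S Q ->
    ('E_Q[fun w => (lambda * gap w S)%R] <= KL_divergence Q P + c)%E ->
    ((risk L D (h (mean_weight Q)))%:E <=
     (empirical_risk L S (h (mean_weight Q)))%:E + (Omega L h D S Q)%:E
     + (lambda^-1)%:E * (KL_divergence Q P + c))%E.
  case=> _ _ _ iD iS.
  rewrite /Omega unlock.
  under eq_integral do rewrite EFinM EFinB.
  rewrite integralZl//; last exact: integrableB.
  rewrite integralB//.
  have : (\int[Q]_w (risk L D (h w))%:E)%E \is a fin_num by exact: integrable_fin_num.
  have : (\int[Q]_w (empirical_risk L S (h w))%:E)%E \is a fin_num.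
    exact: integrable_fin_num.
  case: (\int[Q]_w (empirical_risk L S (h w))%:E)%E => // s _.
  case: (\int[Q]_w (risk L D (h w))%:E)%E => // r _ /=.
  case: (KL_divergence Q P + c)%E => [k| |] //=; last first.
    by move=> _; rewrite gt0_muley ?lte_fin ?invr_gt0// leey.
  rewrite !lee_fin => H.
  suff : r - s <= lambda^-1 * k by lra.
  by rewrite mulrC ler_pdivlMr// mulrC.
(* If [M] is infinite, the right side of the bound is [+oo] and every sample is good. *)
have [Mfin|Minf] := boolP (M \is a fin_num); last first.
  have -> : M = +oo%E by move: M_gt0 Minf; clearbody M; clear; case: M.
  exists setT; first by rewrite probability_setT lee_fin; split=> //; lra.
  move=> S _ Q adm; rewrite -(addeA (KL_divergence Q P)); apply: bound => //.
  rewrite addey ?leey//.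
  by rewrite gt_eqF// (lt_le_trans _ (KL_divergence_ge0 _ _ _ Q P))// ltNy0.
pose c := fine M; have cE : M = c%:E by rewrite fineK.
have c0 : 0 < c by rewrite -lte_fin -cE.
have cd0 : 0 < c / delta by rewrite divr_gt0.
(* The event involves only the prior, so a single one serves all [Q]. *)
exists [set S | (G S < (c / delta)%:E)%E].
  split.
    by rewrite -[X in measurable X]setTI; exact: emeasurable_fun_infty_o.
  by apply: probability_markov => //; [move=> S; exact: ltW|rewrite -cE].
move=> S /= GS Q adm; rewrite -(addeA (KL_divergence Q P)); apply: bound => //.
(* The confidence term and [Psi] merge into the logarithm of the Markov threshold, which is the
   constant used in the change of measure. *)
have -> : ((ln (1 / delta))%:E + lne M = (ln (c / delta))%:E)%E.
  by rewrite cE lne_EFin// -EFinD -lnM ?posrE ?divr_gt0// mulrC mulrA mulr1.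
apply: KL_change_of_measure; last by rewrite lnK ?posrE// ltW.
case: adm => _ _ _ iD iS.
by have := integrableZl measurableT lambda (integrableB measurableT iD iS).
Qed.
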